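(* Consider problem (P) with $\mathcal{X}_i=\mathbb{R}^{d_i}$ for all $i$, under Assumption 1, let $\mathcal{G}$ be undirected and connected, suppose $A=[A_1,\dots,A_n]$ has full row rank, and that each $f_i$ is $\mu_i$-strongly convex and $l_i$-smooth. Let $\mu=\min_i\mu_i$, $l=\max_i l_i$, and let $\beta>0$, $\varphi>0$, $\alpha$ satisfy $$\varphi>\max\Big\{\tfrac{l}{2}-1,\;2\bar\sigma^2(\mathbf{A})\Big\},\qquad \alpha>\max\Big\{1,\;\frac{\frac{\varphi\bar\sigma^2(\mathbf{A})}{\mu}+\frac l2}{\varphi+1-\frac l2}\Big\}.$$ Then for any initial point $(\mathbf{x}(0),\boldsymbol\lambda(0),\mathbf{z}(0))\in\mathbb{R}^d\times\mathbb{R}^{np}\times\mathbb{R}^{np}$ with $\sum_{i=1}^n z_i(0)=0$, the trajectory $(\mathbf{x}(t),\boldsymbol\lambda(t),\mathbf{z}(t))$ of IDEA converges exponentially to a point $(\mathbf{x}^*,\boldsymbol\lambda^*,\mathbf{z}^* )$, where $\mathbf{x}^*$ is the unique optimal solution of (P).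
   Context: Problem (P): for $i=1,\dots,n$ let $f_i:\mathbb{R}^{d_i}\to\mathbb{R}$, $\mathcal{X}_i\subseteq\mathbb{R}^{d_i}$, $A_i\in\mathbb{R}^{p\times d_i}$, $b\in\mathbb{R}^p$; $d=\sum_i d_i$, $\mathbf{x}=[x_1^\top,\dots,x_n^\top]^\top$, $f(\mathbf{x})=\sum_i f_i(x_i)$, $A=[A_1,\dots,A_n]$, $\mathcal{X}=\prod_i\mathcal{X}_i$; (P) is $\min f(\mathbf{x})$ s.t. $A\mathbf{x}=b$, $\mathbf{x}\in\mathcal{X}$, assumed to have at least one optimal solution. Assumption 1: each $\mathcal{X}_i$ is closed and convex, $f_i$ is convex on $\mathcal{X}_i$ and differentiable on an open set containing $\mathcal{X}_i$ with $\nabla f_i$ locally Lipschitz there, and Slater's condition holds (some relative interior point of $\mathcal{X}$ satisfies $A\mathbf{x}=b$). $l_i$-smooth means $\nabla f_i$ is $l_i$-Lipschitz. Graph: weighted graph on $\{1,\dots,n\}$ with adjacency matrix $[a_{ij}]$ ($a_{ij}>0$ if agent $i$ receives from agent $j$, else $0$); Laplacian $L=D^{out}-[a_{ij}]$, $D^{out}=\mathrm{diag}(\sum_j a_{ij})_i$. Undirected means $a_{ij}=a_{ji}$. IDEA: choose $b_1,\dots,b_n\in\mathbb{R}^p$ with $\sum_i b_i=b$; $\mathbf{A}=\mathrm{diag}(A_1,\dots,A_n)\in\mathbb{R}^{np\times d}$, $\mathbf{b}=[b_1^\top,\dots,b_n^\top]^\top$, $\mathbf{L}=L\otimes I_p$,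 $\nabla f(\mathbf{x})=[\nabla f_1(x_1)^\top,\dots,\nabla f_n(x_n)^\top]^\top$, $\boldsymbol\lambda$, $\mathbf{z}=[z_1^\top,\dots,z_n^\top]^\top\in\mathbb{R}^{np}$. IDEA is $\dot{\mathbf{x}}=-\alpha(\nabla f(\mathbf{x})+\mathbf{A}^\top\boldsymbol\lambda)-\mathbf{A}^\top(\mathbf{A}\mathbf{x}-\mathbf{b}-\mathbf{z})$, $\dot{\boldsymbol\lambda}=\mathbf{A}\mathbf{x}-\mathbf{b}-\mathbf{z}-\beta\mathbf{L}\boldsymbol\lambda$, $\dot{\mathbf{z}}=\alpha\beta\mathbf{L}\boldsymbol\lambda$. $\bar\sigma(\mathbf{A})$ is the largest singular value of $\mathbf{A}$. Exponential convergence means $\|(\mathbf{x},\boldsymbol\lambda,\mathbf{z})(t)-(\mathbf{x}^*,\boldsymbol\lambda^*,\mathbf{z}^* )\|\le Ce^{-ct}$ for some $C,c>0$. *)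

(* Defs.v *)
From HB Require Import structures.
From mathcomp Require Import all_boot all_order all_algebra.
From mathcomp Require Import all_classical all_reals all_analysis.
Set Implicit Arguments. Unset Strict Implicit. Unset Printing Implicit Defensive.
Import Order.TTheory GRing.Theory Num.Theory.
Import numFieldNormedType.Exports.
Local Open Scope ring_scope.
Local Open Scope classical_set_scope.

Section IDEADefs.
Variable R : realType.

Definition dotv (k : nat) (u v : 'cV[R]_k) : R := \sum_(j < k) u j 0 * v j 0.
Definition enorm (k : nat) (u : 'cV[R]_k) : R := Num.sqrt (dotv u u).

Definition has_gradient (k : nat) (f : 'cV[R]_k -> R) (g : 'cV[R]_k -> 'cV[R]_k) :=
  forall x, differentiable f x /\ forall v, is_derive x v f (dotv v (g x)).

Definition strongly_convex (k : nat) (mu : R) (f : 'cV[R]_k -> R) :=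
  0 < mu /\
  forall (x y : 'cV[R]_k) (th : R), 0 <= th <= 1 ->
    f (th *: x + (1 - th) *: y) <=
      th * f x + (1 - th) * f y - mu / 2 * th * (1 - th) * (enorm (x - y)) ^+ 2.

Definition lipschitz_grad (k : nat) (l : R) (g : 'cV[R]_k -> 'cV[R]_k) :=
  forall x y, enorm (g x - g y) <= l * enorm (x - y).

Definition locally_lipschitz (k : nat) (g : 'cV[R]_k -> 'cV[R]_k) :=
  forall x0 : 'cV[R]_k, exists r L : R, 0 < r /\
    forall x y, enorm (x - x0) < r -> enorm (y - x0) < r ->
      enorm (g x - g y) <= L * enorm (x - y).

Variables (n p : nat) (d : 'I_n -> nat).

Definition feasible (A : forall i, 'M[R]_(p, d i)) (b : 'cV[R]_p)
  (x : forall i, 'cV[R]_(d i)) := \sum_(i < n) A i *m x i = b.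

Definition optimal (f : forall i, 'cV[R]_(d i) -> R) (A : forall i, 'M[R]_(p, d i))
  (b : 'cV[R]_p) (x : forall i, 'cV[R]_(d i)) :=
  feasible A b x /\
  forall y, feasible A b y -> \sum_(i < n) f i (x i) <= \sum_(i < n) f i (y i).

Definition Arow (A : forall i, 'M[R]_(p, d i)) : 'M[R]_(p, \sum_(i < n) d i) :=
  \mxrow_(i < n) A i.

Definition Adiag (A : forall i, 'M[R]_(p, d i)) :
  'M[R]_(\sum_(i < n) p, \sum_(j < n) d j) :=
  \mxblock_(i < n, j < n) (if i == j then A j else 0).

Definition sigma_max (m k : nat) (M : 'M[R]_(m, k)) : R :=
  Num.sqrt (sup [set a : R | eigenvalue (M^T *m M) a]).

Definition laplacian (a : 'M[R]_n) : 'M[R]_n :=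
  \matrix_(i, j) ((if i == j then \sum_(k < n) a i k else 0) - a i j).

(* (L (x) I_p) lambda, component i *)
Definition lapl_apply (a : 'M[R]_n) (lam : 'I_n -> 'cV[R]_p) (i : 'I_n) : 'cV[R]_p :=
  \sum_(j < n) laplacian a i j *: lam j.

Definition undirected_graph (a : 'M[R]_n) :=
  (forall i j, 0 <= a i j) /\ (forall i j, a i j = a j i).

Definition graph_connected (a : 'M[R]_n) :=
  forall i j : 'I_n, connect (fun u v => 0 < a u v) i j.

Definition IDEA_solution (alpha beta : R) (gf : forall i, 'cV[R]_(d i) -> 'cV[R]_(d i))
  (A : forall i, 'M[R]_(p, d i)) (bs : 'I_n -> 'cV[R]_p) (a : 'M[R]_n)
  (X : R -> forall i, 'cV[R]_(d i)) (Lam Z : R -> 'I_n -> 'cV[R]_p) :=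
  (forall i,
     (fun s => X s i) @ at_right 0 --> X 0 i /\
     (fun s => Lam s i) @ at_right 0 --> Lam 0 i /\
     (fun s => Z s i) @ at_right 0 --> Z 0 i) /\
  forall t : R, 0 < t -> forall i,
    is_derive (t : R^o) (1 : R^o) (fun s : R^o => X s i)
      (- (alpha *: (gf i (X t i) + (A i)^T *m Lam t i))
       - (A i)^T *m (A i *m X t i - bs i - Z t i)) /\
    is_derive (t : R^o) (1 : R^o) (fun s : R^o => Lam s i)
      (A i *m X t i - bs i - Z t i - beta *: lapl_apply a (Lam t) i) /\
    is_derive (t : R^o) (1 : R^o) (fun s : R^o => Z s i)
      ((alpha * beta) *: lapl_apply a (Lam t) i).

Definition state_dist (x x0 : forall i, 'cV[R]_(d i)) (lam lam0 z z0 : 'I_n -> 'cV[R]_p) : R :=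
  Num.sqrt (\sum_(i < n) (enorm (x i - x0 i) ^+ 2 + enorm (lam i - lam0 i) ^+ 2
                          + enorm (z i - z0 i) ^+ 2)).

End IDEADefs.

(* Main.v *)
Require Import Defs.
From HB Require Import structures.
From mathcomp Require Import all_boot all_order all_algebra.
From mathcomp Require Import all_classical all_reals all_analysis.
From mathcomp Require Import ring lra.
Set Implicit Arguments. Unset Strict Implicit. Unset Printing Implicit Defensive.
Import Order.TTheory GRing.Theory Num.Theory.
Import numFieldNormedType.Exports.
Local Open Scope classical_set_scope.
Local Open Scope ring_scope.

(** Write [x], [lam], [z] for the deviations from a KKT point, [y = A x - z], and
    let [P] invert the Laplacian [L] on zero-sum vectors. The function
      [V = |x|^2 / 2 + |alpha lam + z|^2 / (2 alpha) + <P z, z> / (2 beta)]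
    satisfies [V' = - alpha <x, grad f - grad f*> - |y|^2], because
    [alpha lam' + z' = alpha y] and [L P z = z]. This controls [x] and
    [z = A x - y] but not [lam]. Since [y' = A x' - z'], the cross term [<lam, y>]
    has derivative at most [- alpha/2 (|A^T lam|^2 + beta <lam, L lam>)] up to
    multiples of [|x|^2 + |y|^2], and full row rank together with connectedness
    makes this form coercive in [lam]. Hence [V + eps <lam, y>] is, for small
    [eps], a quadratic Lyapunov function that decays exponentially for all
    [alpha, beta > 0]. *)

(** * Inner products and quadratic bounds for column vectors *)

Section EuclideanVectors.
Variable R : realType.

Section Dotv.
Variable k : nat.
Implicit Types (u v w : 'cV[R]_k) (c : R).

Lemma dotvC u v : dotv u v = dotv v u.
Proof. by apply: eq_bigr => j _; rewrite mulrC. Qed.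

Lemma dotvDl u v w : dotv (u + v) w = dotv u w + dotv v w.
Proof. by rewrite -big_split; apply: eq_bigr => j _; rewrite mxE mulrDl. Qed.

Lemma dotvZl c u v : dotv (c *: u) v = c * dotv u v.
Proof. by rewrite mulr_sumr; apply: eq_bigr => j _; rewrite mxE mulrA. Qed.

Lemma dotvNl u v : dotv (- u) v = - dotv u v.
Proof. by rewrite -scaleN1r dotvZl mulN1r. Qed.

Lemma dotvDr u v w : dotv u (v + w) = dotv u v + dotv u w.
Proof. by rewrite dotvC dotvDl !(dotvC u). Qed.

Lemma dotvZr c u v : dotv u (c *: v) = c * dotv u v.
Proof. by rewrite dotvC dotvZl dotvC. Qed.

Lemma dotvNr u v : dotv u (- v) = - dotv u v.
Proof. by rewrite dotvC dotvNl dotvC. Qed.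

Definition dotvE := (dotvDl, dotvDr, dotvNl, dotvNr, dotvZl, dotvZr).

Lemma dotv0l v : dotv 0 v = 0.
Proof. by rewrite -(scale0r v) dotvZl mul0r. Qed.

Lemma dotv_suml (I : finType) (F : I -> 'cV[R]_k) v :
  dotv (\sum_i F i) v = \sum_i dotv (F i) v.
Proof.
by apply: (big_morph (fun u => dotv u v)) => [u w|]; rewrite (dotvDl, dotv0l).
Qed.

Lemma dotv_sumr (I : finType) (F : I -> 'cV[R]_k) v :
  dotv v (\sum_i F i) = \sum_i dotv v (F i).
Proof. by rewrite dotvC dotv_suml; apply: eq_bigr => i _; rewrite dotvC. Qed.

Lemma dotv_ge0 u : 0 <= dotv u u.
Proof. by apply: sumr_ge0 => j _; rewrite -expr2 sqr_ge0. Qed.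

Lemma dotv_eq0 u : dotv u u = 0 -> u = 0.
Proof.
move=> /psumr_eq0P u0; apply/matrixP => i j; rewrite ord1 mxE.
by apply/eqP; rewrite -sqrf_eq0 expr2 u0 // => l _; rewrite -expr2 sqr_ge0.
Qed.

Lemma enorm_sqr u : enorm u ^+ 2 = dotv u u.
Proof. by rewrite sqr_sqrtr ?dotv_ge0. Qed.

Lemma enorm_ge0 u : 0 <= enorm u.
Proof. exact: sqrtr_ge0. Qed.

(** Expand [|2 c u - v|^2 >= 0] and divide by [4 c]. *)
Lemma dotv_young c u v : 0 < c ->
  dotv u v <= c * dotv u u + (4 * c)^-1 * dotv v v.
Proof.
move=> c0; have := dotv_ge0 ((2 * c) *: u - v).
rewrite !dotvE (dotvC v u) => H.
have -> : dotv u v = (4 * c)^-1 * (4 * c * dotv u v).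
  by field; rewrite gt_eqF.
have -> : c * dotv u u = (4 * c)^-1 * (4 * c * (c * dotv u u)).
  by field; rewrite gt_eqF.
by rewrite -mulrDr ler_wpM2l ?invr_ge0; nra.
Qed.

Lemma dotvD_le u v : dotv (u + v) (u + v) <= 2 * dotv u u + 2 * dotv v v.
Proof. by have := dotv_ge0 (u - v); rewrite !dotvE (dotvC v u); lra. Qed.

(** For [v <> 0], the squared norm of [|v|^2 u - <u, v> v] is [|v|^2] times the gap between the two
    sides. *)
Lemma dotv_CS u v : dotv u v ^+ 2 <= dotv u u * dotv v v.
Proof.
have [v0|v0] := eqVneq (dotv v v) 0.
  by rewrite (dotv_eq0 v0) dotvC !dotv0l expr0n mulr0.
have vp : 0 < dotv v v by rewrite lt_neqAle eq_sym v0 dotv_ge0.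
have := dotv_ge0 (dotv v v *: u - dotv u v *: v).
rewrite !dotvE (dotvC v u) => H; rewrite -subr_ge0 -(pmulr_rge0 _ vp).
by apply: le_trans H _; rewrite le_eqVlt; apply/orP; left; apply/eqP; ring.
Qed.

End Dotv.

Lemma dotv_mulmx m k (M : 'M[R]_(m, k)) u v :
  dotv (M *m u) v = dotv u (M^T *m v).
Proof.
rewrite /dotv; under eq_bigr do rewrite mxE mulr_suml.
rewrite exchange_big; apply: eq_bigr => j _.
by rewrite mxE mulr_sumr; apply: eq_bigr => i _; rewrite mxE; ring.
Qed.

(** The squared Frobenius norm of [M] works, by Cauchy-Schwarz on each row. *)
Lemma mulmx_bounded m k (M : 'M[R]_(m, k)) :
  exists K : R, forall u, dotv (M *m u) (M *m u) <= K * dotv u u.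
Proof.
exists (\sum_i dotv (row i M)^T (row i M)^T) => u.
rewrite {1}/dotv mulr_suml; apply: ler_sum => i _.
rewrite -expr2; suff -> : (M *m u) i 0 = dotv (row i M)^T u by exact: dotv_CS.
by rewrite mxE; apply: eq_bigr => j _; rewrite !mxE.
Qed.

(** Sum [<F i, F j> <= (|F i|^2 + |F j|^2) / 2] over all pairs. *)
Lemma dotv_sum_le k n (F : 'I_n -> 'cV[R]_k) :
  dotv (\sum_i F i) (\sum_i F i) <= n%:R * \sum_i dotv (F i) (F i).
Proof.
have S : \sum_(i < n) \sum_(j < n) dotv (F i) (F i) = n%:R * \sum_i dotv (F i) (F i).
  under eq_bigr do rewrite sumr_const card_ord -mulr_natl.
  by rewrite -mulr_sumr.
rewrite dotv_suml; under eq_bigr do rewrite dotv_sumr.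
have -> : n%:R * \sum_i dotv (F i) (F i) =
    \sum_i \sum_j (dotv (F i) (F i) + dotv (F j) (F j)) / 2.
  under [RHS]eq_bigr do rewrite -mulr_suml big_split.
  rewrite -mulr_suml big_split /= [X in _ + X]exchange_big /= S; lra.
apply: ler_sum => i _; apply: ler_sum => j _.
by have := dotv_ge0 (F i - F j); rewrite !dotvE (dotvC (F j) (F i)); lra.
Qed.

(** Merges finitely many constants into one. The summand 1 in the witness keeps it positive even for
    an empty index type. *)
Lemma common_bound (I : finType) (P : I -> R -> Prop) :
  (forall i K K', K <= K' -> P i K -> P i K') ->
  (forall i, exists K, P i K) ->
  exists K, 0 < K /\ forall i, P i K.
Proof.
move=> mono /choice [K PK]; exists (1 + \sum_i `|K i|); split.
  by rewrite ltr_pwDl ?ltr01 ?sumr_ge0.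
move=> i; apply: (mono i (K i)) (PK i).
rewrite (bigD1 i) //=; have := ler_norm (K i).
have : 0 <= \sum_(j | j != i) `|K j| by apply: sumr_ge0.
lra.
Qed.

Lemma mulmx_family_bounded (I : finType) (m k : I -> nat)
    (M : forall i, 'M[R]_(m i, k i)) :
  exists K, 0 < K /\ forall i u, dotv (M i *m u) (M i *m u) <= K * dotv u u.
Proof.
apply: common_bound => [i K K' KK' H u|i]; last exact: mulmx_bounded.
by apply: le_trans (H u) _; rewrite ler_wpM2r ?dotv_ge0.
Qed.

End EuclideanVectors.

(** * Laplacian energy *)

Section Laplacian.
Variables (R : realType) (n p : nat) (a : 'M[R]_n).
Implicit Types U V : 'I_n -> 'cV[R]_p.

Definition lapl_energy U : R := \sum_i dotv (U i) (lapl_apply a U i).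

Lemma lapl_applyE U i : lapl_apply a U i = \sum_j a i j *: (U i - U j).
Proof.
rewrite /lapl_apply; under eq_bigr do rewrite mxE scalerBl.
under [RHS]eq_bigr do rewrite scalerBr.
rewrite !sumrB; congr (_ - _).
rewrite -scaler_suml (bigD1 i) //= eqxx [X in _ + X]big1 ?addr0 // => j /negPf.
by rewrite eq_sym => ->; rewrite scale0r.
Qed.

Lemma lapl_apply_cst (u : 'cV[R]_p) i : lapl_apply a (fun=> u) i = 0.
Proof. by rewrite lapl_applyE big1 // => j _; rewrite subrr scaler0. Qed.

Lemma lapl_applyB U V i :
  lapl_apply a (fun j => U j - V j) i = lapl_apply a U i - lapl_apply a V i.
Proof. by rewrite -sumrB; apply: eq_bigr => j _; rewrite scalerBr. Qed.

Hypothesis undir : undirected_graph a.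

Lemma laplacian_sym i j : laplacian a i j = laplacian a j i.
Proof.
by rewrite !mxE undir.2 eq_sym; case: eqVneq => // ->.
Qed.

Lemma lapl_apply_adj U V :
  \sum_i dotv (U i) (lapl_apply a V i) = \sum_i dotv (lapl_apply a U i) (V i).
Proof.
under eq_bigr do rewrite dotv_sumr.
under [RHS]eq_bigr do rewrite dotv_suml.
rewrite exchange_big; apply: eq_bigr => i _; apply: eq_bigr => j _.
by rewrite !dotvE laplacian_sym.
Qed.

(** Pair the sum with itself: self-adjointness moves the Laplacian onto a constant family, which it
    kills. *)
Lemma lapl_apply_sum0 U : \sum_i lapl_apply a U i = 0.
Proof.
apply: dotv_eq0; rewrite dotv_suml -lapl_apply_adj big1 // => i _.
by rewrite lapl_apply_cst dotvC dotv0l.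
Qed.

(** Average the two expressions [E1] and [E2], which differ by exchanging [i] and [j]. *)
Lemma lapl_energyE U :
  lapl_energy U = \sum_i \sum_j a i j * dotv (U i - U j) (U i - U j) / 2.
Proof.
have E1 : lapl_energy U = \sum_i \sum_j a i j * dotv (U i) (U i - U j).
  apply: eq_bigr => i _; rewrite lapl_applyE dotv_sumr.
  by apply: eq_bigr => j _; rewrite dotvZr.
have E2 : lapl_energy U = \sum_i \sum_j - (a i j * dotv (U j) (U i - U j)).
  rewrite E1 exchange_big; apply: eq_bigr => i _; apply: eq_bigr => j _.
  by rewrite undir.2 !dotvE; ring.
have -> : lapl_energy U = (lapl_energy U + lapl_energy U) / 2 by field.
rewrite {1}E1 E2 -big_split mulr_suml; apply: eq_bigr => i _.
rewrite -big_split mulr_suml; apply: eq_bigr => j _ /=.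
by rewrite !dotvE; ring.
Qed.

Lemma lapl_energy_ge0 U : 0 <= lapl_energy U.
Proof.
rewrite lapl_energyE; apply: sumr_ge0 => i _; apply: sumr_ge0 => j _.
by rewrite divr_ge0 // mulr_ge0 ?undir.1 // dotv_ge0.
Qed.

Lemma edge_le_lapl_energy U i j :
  a i j * dotv (U i - U j) (U i - U j) <= 2 * lapl_energy U.
Proof.
have P i' j' : 0 <= a i' j' * dotv (U i' - U j') (U i' - U j') / 2.
  by rewrite divr_ge0 // mulr_ge0 ?undir.1 // dotv_ge0.
rewrite lapl_energyE (bigD1 i) //= (bigD1 j) //=.
set x := \sum_(_ | _ != j) _; set y := \sum_(_ | _) _.
have : 0 <= x by apply: sumr_ge0.
have : 0 <= y by apply: sumr_ge0 => i' _; apply: sumr_ge0.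
lra.
Qed.

(** Bounding by the energy rather than by [|U|^2] lets terms in [L lam] be absorbed by the
    dissipation [<lam, L lam>]. One factor [a i j] of the squared weight is bounded by [K], the
    other is kept for the edge estimate. *)
Lemma lapl_apply_le_energy : exists K, 0 < K /\
  forall U i, dotv (lapl_apply a U i) (lapl_apply a U i) <= K * lapl_energy U.
Proof.
have [K [K0 HK]] : exists K, 0 < K /\ forall ij, a ij.1 ij.2 <= K.
  apply: common_bound => [ij x y xy H|ij]; first exact: le_trans H xy.
  by exists (a ij.1 ij.2).
exists (1 + n%:R * (n%:R * (K * 2))); split.
  by rewrite ltr_pwDl // !mulr_ge0 // ltW.
move=> U i; have E0 := lapl_energy_ge0 U.
rewrite lapl_applyE; apply: le_trans; first exact: dotv_sum_le.
rewrite mulrDl mul1r -mulrA -[leLHS]add0r lerD // ler_wpM2l //.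
have -> : n%:R * (K * 2) * lapl_energy U = \sum_(j < n) K * (2 * lapl_energy U).
  by rewrite sumr_const card_ord -mulr_natl; ring.
apply: ler_sum => j _; rewrite dotvZl dotvZr ler_pM ?undir.1 ?(HK (i, j)) //.
  by rewrite mulr_ge0 ?undir.1 ?dotv_ge0.
exact: edge_le_lapl_energy.
Qed.

Hypothesis conn : graph_connected a.

(** Induction along a path from [i] to [j], each edge of which is controlled by the energy. *)
Lemma poincare : exists K, 0 < K /\
  forall U i j, dotv (U i - U j) (U i - U j) <= K * lapl_energy U.
Proof.
suff [K [K0 HK]] : exists K, 0 < K /\ forall ij U,
    dotv (U ij.1 - U ij.2) (U ij.1 - U ij.2) <= K * lapl_energy U.
  by exists K; split=> // U i j; exact: (HK (i, j)).
apply: common_bound => [ij K K' KK' H U|[i j] /=].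
  by apply: le_trans (H U) _; rewrite ler_wpM2r ?lapl_energy_ge0.
have /connectP [q + ->] := conn i j.
elim: q i => [|i' q IH] i /= => [_|/andP [e /IH [K HK]]].
  by exists 0 => U; rewrite subrr dotv0l mul0r.
(* The outer factors 2 come from [dotvD_le]; the first edge costs [2 / a i i'] energies, the rest of
   the path [K]. *)
exists (2 * (2 / a i i') + 2 * K) => U.
rewrite -[U i - _](subrKA (U i')); apply: le_trans; first exact: dotvD_le.
rewrite [leRHS]mulrDl -!mulrA lerD // ler_wpM2l //.
by rewrite mulrCA ler_pdivlMl // edge_le_lapl_energy.
Qed.

End Laplacian.

(** * A symmetric right inverse of the Laplacian on zero-sum families *)

Section LaplacianInverse.
Variables (R : realType) (n : nat) (a : 'M[R]_n).
Hypothesis undir : undirected_graph a.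
Hypothesis conn : graph_connected a.

Lemma laplacian_col_sum k : \sum_i laplacian a i k = 0.
Proof.
transitivity (lapl_apply a (fun=> const_mx 1 : 'cV[R]_1) k 0 0); last first.
  by rewrite lapl_apply_cst mxE.
rewrite summxE; apply: eq_bigr => i _.
by rewrite [RHS]mxE [X in _ * X]mxE mulr1 laplacian_sym.
Qed.

(* [P] is the inverse of the Laplacian plus the all-ones matrix. *)
Lemma lapl_section : exists P : 'M[R]_n, P^T = P /\
  forall (p : nat) (Z : 'I_n -> 'cV[R]_p), \sum_i Z i = 0 ->
    forall i, lapl_apply a (fun j => \sum_k P j k *: Z k) i = Z i.
Proof.
pose J : 'M[R]_n := const_mx 1; pose L := laplacian a.
(* If [v (L + J) = 0], then [v (L + J) v^T], the energy of [v] plus the square of its sum, vanishes.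
   So both parts do: [v] is constant by connectedness and has zero sum. *)
have M_unit : L + J \in unitmx.
  rewrite -row_free_unit; apply: inj_row_free => v vM0.
  pose U (i : 'I_n) : 'cV[R]_1 := const_mx (v 0 i).
  have E0 : lapl_energy a U + (\sum_i v 0 i) ^+ 2 = 0.
    transitivity ((v *m (L + J) *m v^T) 0 0); last by rewrite vM0 mul0mx mxE.
    rewrite mulmxDr mulmxDl [RHS]mxE; congr (_ + _).
      rewrite [RHS]mxE; apply: eq_bigr => i _.
      rewrite dotvC dotv_suml [(v *m L) 0 i]mxE mulr_suml; apply: eq_bigr => j _.
      rewrite dotvZl /dotv big_ord1 [U i 0 0]mxE [U j 0 0]mxE [v^T i 0]mxE.
      by rewrite (laplacian_sym undir) /L; ring.
    rewrite expr2 mulr_sumr [RHS]mxE; apply: eq_bigr => i _.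
    rewrite [(v *m J) 0 i]mxE [v^T i 0]mxE; congr (_ * _).
    by apply: eq_bigr => j _; rewrite [J j i]mxE mulr1.
  have [E00 S0] : lapl_energy a U = 0 /\ \sum_i v 0 i = 0.
    have := lapl_energy_ge0 undir U; have := sqr_ge0 (\sum_i v 0 i) => h1 h2.
    by split; [lra|apply/eqP; rewrite -sqrf_eq0; apply/eqP; lra].
  have vcst i j : v 0 i = v 0 j.
    have [K [K0 /(_ U i j)]] := poincare 1 undir conn.
    rewrite E00 mulr0 => H; have := dotv_ge0 (U i - U j) => H'.
    have /dotv_eq0/matrixP/(_ 0 0) : dotv (U i - U j) (U i - U j) = 0 by lra.
    by rewrite !mxE => /eqP; rewrite subr_eq0 => /eqP.
  apply/matrixP => i j; rewrite ord1 [RHS]mxE; move: S0.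
  under eq_bigr do rewrite (vcst _ j).
  rewrite sumr_const card_ord -mulr_natl => /eqP; rewrite mulf_eq0 pnatr_eq0.
  by rewrite eqn0Ngt (leq_ltn_trans _ (ltn_ord j)) // => /eqP.
exists (invmx (L + J)); split.
  rewrite trmx_inv; congr invmx; apply/matrixP => i j.
  by rewrite 2![LHS]mxE [RHS]mxE [J j i]mxE [J i j]mxE (laplacian_sym undir).
move=> p Z Z0 i.
have n0 : (n%:R : R) != 0 by rewrite pnatr_eq0 -lt0n (leq_ltn_trans _ (ltn_ord i)).
(* Since [J L = 0] and [J J = n J], multiplying by the inverse leads to [L P = 1 - J / n], the
   projection onto zero-sum families. *)
have JM : J *m (L + J) = n%:R *: J.
  apply/matrixP => j k; rewrite mulmxDr.
  rewrite [LHS]mxE [(J *m L) j k]mxE [(J *m J) j k]mxE [RHS]mxE [J j k]mxE mulr1.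
  under eq_bigr do rewrite [J j _]mxE mul1r.
  under [X in _ + X]eq_bigr do rewrite [J j _]mxE [J _ k]mxE mulr1.
  by rewrite laplacian_col_sum sumr_const card_ord add0r.
have JP : J *m invmx (L + J) = n%:R^-1 *: J.
  by rewrite -[LHS](scalerK n0) scalemxAl -JM mulmxK.
have LP : L *m invmx (L + J) = 1%:M - n%:R^-1 *: J.
  by rewrite -JP -(mulmxV M_unit) mulmxDl addrK.
transitivity (\sum_k (L *m invmx (L + J)) i k *: Z k).
  rewrite /lapl_apply; under eq_bigr do rewrite scaler_sumr.
  rewrite exchange_big; apply: eq_bigr => k _.
  by rewrite mxE scaler_suml; apply: eq_bigr => j _; rewrite scalerA.
rewrite LP.
under eq_bigr => k _ do rewrite !mxE mulr1 scalerBl.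
rewrite sumrB -scaler_sumr Z0 scaler0 subr0 (bigD1 i) //= eqxx scale1r.
by rewrite big1 ?addr0 // => k; rewrite eq_sym => /negPf ->; rewrite scale0r.
Qed.
End LaplacianInverse.

(** * Coercivity in the multipliers from full row rank and connectedness *)

Section Coercivity.
Variables (R : realType) (n p : nat) (d : 'I_n -> nat).
Variable A : forall i, 'M[R]_(p, d i).

Lemma Arow_right_inverse : \rank (Arow A) = p ->
  exists B : forall i, 'M[R]_(d i, p), \sum_i A i *m B i = 1%:M.
Proof.
move=> /eqP/row_freeP [B AB]; exists (fun i => submxcol B i).
by rewrite -mul_mxrow_mxcol submxcolK.
Qed.

(** Quantitative form of a kernel argument: zero energy forces consensus, and a common [lam] killed
    by every [(A i)^T] is zero by full row rank. *)
Lemma consensus_coercive (a : 'M[R]_n) :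
  undirected_graph a -> graph_connected a -> \rank (Arow A) = p ->
  exists K, 0 < K /\ forall lam : 'I_n -> 'cV[R]_p,
    \sum_i dotv (lam i) (lam i) <=
      K * (\sum_i dotv ((A i)^T *m lam i) ((A i)^T *m lam i) + lapl_energy a lam).
Proof.
move=> undir conn /Arow_right_inverse [B AB].
have [KP [KP0 HP]] := poincare p undir conn.
have [KA [KA0 HA]] := mulmx_family_bounded (fun i => (A i)^T).
have [KB [KB0 HB]] := mulmx_family_bounded (fun i => (B i)^T).
(* [lam_j = sum_i B_i^T A_i^T lam_j], where the Poincare inequality allows
   replacing [A_i^T lam_j] by [A_i^T lam_i]. *)
exists (1 + n%:R * (n%:R * KB * (2 + 2 * KA * n%:R * KP))); split.
  by rewrite ltr_pwDl // !(mulr_ge0, addr_ge0) // ltW.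
move=> lam; set F := \sum_i dotv (_ *m _) _; set E := lapl_energy a lam.
have F0 : 0 <= F by apply: sumr_ge0 => i _; exact: dotv_ge0.
have E0 : 0 <= E by exact: lapl_energy_ge0.
suff le_j j : dotv (lam j) (lam j) <= n%:R * KB * (2 + 2 * KA * n%:R * KP) * (F + E).
  rewrite mulrDl mul1r -[leLHS]add0r lerD ?addr_ge0 // -mulrA mulr_natl.
  rewrite -[X in _ *+ X]card_ord -sumr_const; exact: ler_sum.
have -> : lam j = \sum_i (B i)^T *m ((A i)^T *m lam j).
  rewrite -[LHS]mul1mx -trmx1 -AB raddf_sum mulmx_suml.
  by apply: eq_bigr => i _; rewrite /= trmx_mul mulmxA.
apply: le_trans; first exact: dotv_sum_le.
rewrite -!mulrA ler_wpM2l // !mulrA.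
apply: (@le_trans _ _ (\sum_i KB * (2 * dotv ((A i)^T *m lam i) ((A i)^T *m lam i)
    + 2 * KA * KP * E))).
  apply: ler_sum => i _; apply: le_trans (HB _ _) _; rewrite ler_pM2l //.
  rewrite -[lam j](subrK (lam i)) mulmxDr addrC; apply: le_trans; first exact: dotvD_le.
  rewrite lerD2l -!mulrA ler_pM2l //; apply: le_trans (HA _ _) _.
  by rewrite ler_pM2l //; exact: HP.
rewrite -mulr_sumr big_split /= -mulr_sumr sumr_const card_ord -mulr_natl -[leRHS]mulrA.
rewrite ler_pM2l // -/F -subr_ge0.
pose c := 2 * KA * n%:R * KP.
have c0 : 0 <= c by rewrite !mulr_ge0 // ltW.
have : 0 <= c * F + 2 * E by rewrite addr_ge0 // mulr_ge0.
by rewrite /c; lra.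
Qed.

End Coercivity.

(** * Gradient inequality and optimality conditions *)

Section Gradient.
Variables (R : realType) (k : nat) (f : 'cV[R]_k -> R) (g : 'cV[R]_k -> 'cV[R]_k).
Hypothesis fg : has_gradient f g.

(** Strong convexity with weight [h] on [y] bounds the difference quotient by
    [f y - f x - mu / 2 * (1 - h) * N]; let [h] tend to 0 from the right. *)
Lemma gradient_inequality mu x y : strongly_convex mu f ->
  f x + dotv (y - x) (g x) + mu / 2 * dotv (y - x) (y - x) <= f y.
Proof.
move=> [mu0 cvx]; set N := dotv (y - x) (y - x).
have [dfx dfE] := (fg x).2 (y - x).
pose q h := h^-1 *: (f (h *: (y - x) + x) - f x).
have q_cvg : q h @[h --> 0^'+] --> dotv (y - x) (g x).
  apply: cvg_dnbhs_at_right; rewrite -dfE; exact: dfx.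
have r_cvg : (f y - f x - mu / 2 * (1 - h) * N) @[h --> 0^'+] -->
    (f y - f x - mu / 2 * (1 - 0) * N).
  apply: cvg_at_right_filter; apply: cvgB; first exact: cvg_cst.
  apply: cvgMl; apply: cvgMr; apply: cvgB; [exact: cvg_cst|exact: cvg_id].
suff : dotv (y - x) (g x) <= f y - f x - mu / 2 * (1 - 0) * N by lra.
apply: ler_cvg_to q_cvg r_cvg _; near=> h.
have h0 : 0 < h by [].
have h1 : h <= 1 by near: h; exact: nbhs_right_le.
have := cvx y x h; rewrite (ltW h0) h1 => /(_ isT).
have -> : h *: y + (1 - h) *: x = h *: (y - x) + x.
  by rewrite scalerBr scalerBl scale1r -!addrA [- _ + _]addrC.
rewrite enorm_sqr -/N /q /= => H.
by rewrite [_ *: _]mulrC ler_pdivrMr //; lra.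
Unshelve. all: by end_near. Qed.

(** Add the gradient inequalities from [x] to [y] and from [y] to [x]. *)
Lemma strongly_monotone mu x y : strongly_convex mu f ->
  mu * dotv (x - y) (x - y) <= dotv (x - y) (g x - g y).
Proof.
move=> cvx; have := gradient_inequality x y cvx; have := gradient_inequality y x cvx.
by rewrite -(opprB x y) !dotvE; lra.
Qed.

End Gradient.

Lemma lipschitz_grad_sqr (R : realType) k l (g : 'cV[R]_k -> 'cV[R]_k) x y :
  lipschitz_grad l g ->
  dotv (g x - g y) (g x - g y) <= l ^+ 2 * dotv (x - y) (x - y).
Proof.
move=> /(_ x y) H; rewrite -!enorm_sqr -exprMn ler_pXn2r // nnegrE ?enorm_ge0 //.
exact: le_trans (enorm_ge0 _) H.
Qed.

Section KKT.
Variables (R : realType) (n p : nat) (d : 'I_n -> nat).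
Variables (f : forall i, 'cV[R]_(d i) -> R) (g : forall i, 'cV[R]_(d i) -> 'cV[R]_(d i)).
Variables (A : forall i, 'M[R]_(p, d i)) (b : 'cV[R]_p).
Variables (mus ls : 'I_n -> R).
Arguments f {i}.
Arguments g {i}.
Hypothesis fg : forall i, has_gradient (@f i) (@g i).
Hypothesis cvx : forall i, strongly_convex (mus i) (@f i).
Hypothesis lip : forall i, lipschitz_grad (ls i) (@g i).

(** The change of the objective along [x + t v] is at most [t S + t^2 C], so optimality makes this
    polynomial nonnegative for every real [t], which forces [S = 0]. *)
Lemma optimal_stationary x : optimal (@f) A b x ->
  forall v : (forall i, 'cV[R]_(d i)), \sum_i A i *m v i = 0 ->
    \sum_i dotv (v i) (g (x i)) = 0.
Proof.
move=> [feas opt] v Av; set S := \sum_i _.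
(* The coefficients 1 and 1/4 are those of Young's inequality with parameter 1, applied to [t v] and
   the gradient increment. *)
pose C := \sum_i (1 + ls i ^+ 2 / 4) * dotv (v i) (v i).
have C0 : 0 <= C.
  apply: sumr_ge0 => i _; rewrite mulr_ge0 ?dotv_ge0 //.
  by have := sqr_ge0 (ls i); lra.
(* Gradient inequality at [x + t v], then the Lipschitz bound on [g (x + t v) - g x]. *)
have key t : 0 <= t * S + t ^+ 2 * C.
  have xt_feas : feasible A b (fun i => x i + t *: v i).
    rewrite /feasible; under eq_bigr do rewrite mulmxDr -scalemxAr.
    by rewrite big_split /= feas -scaler_sumr Av scaler0 addr0.
  have := opt _ xt_feas; rewrite -subr_ge0 -sumrB => /le_trans; apply.
  rewrite /S /C !mulr_sumr -big_split /=; apply: ler_sum => i _.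
  have := gradient_inequality (@fg i) (x i + t *: v i) (x i) (@cvx i).
  have := lipschitz_grad_sqr (x i + t *: v i) (x i) (@lip i).
  have := dotv_young (t *: v i) (g (x i + t *: v i) - g (x i)) (@ltr01 R).
  rewrite opprD addrA subrr add0r (addrC (x i)) addrK !dotvE.
  have : 0 <= mus i * t ^+ 2 * dotv (v i) (v i).
    by rewrite mulr_ge0 ?dotv_ge0 // mulr_ge0 ?sqr_ge0 // ltW // (@cvx i).1.
  lra.
(* At [t = - w] the polynomial equals [- w^2]. *)
pose w := S / (1 + C).
have SE : S = w * (1 + C) by rewrite divfK // gt_eqF //; lra.
have := key (- w); rewrite SE => wle.
suff -> : w = 0 by rewrite mul0r.
by apply/eqP; rewrite -sqrf_eq0 eq_le sqr_ge0 andbT; lra.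
Qed.

(** With [B] a right inverse of [A], every [u - B A u] lies in the kernel of [A]. Stationarity there
    says that [g - A^T c] with [c = B^T g] is orthogonal to all [u], hence to itself. *)
Lemma kkt_multiplier x : \rank (Arow A) = p -> optimal (@f) A b x ->
  exists lam0 : 'cV[R]_p, forall i, g (x i) + (A i)^T *m lam0 = 0.
Proof.
move=> /Arow_right_inverse [B AB] /optimal_stationary stat.
pose c := \sum_i (B i)^T *m g (x i); exists (- c).
have orth (u : forall i, 'cV[R]_(d i)) : \sum_i dotv (u i) (g (x i) - (A i)^T *m c) = 0.
  pose s := \sum_i A i *m u i.
  have := stat (fun i => u i - B i *m s).
  have -> : \sum_i A i *m (u i - B i *m s) = 0.
    under eq_bigr do rewrite mulmxBr mulmxA.
    by rewrite sumrB -mulmx_suml AB mul1mx subrr.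
  move=> /(_ erefl).
  under eq_bigr do rewrite !dotvE (dotv_mulmx (B _)).
  rewrite sumrB -dotv_sumr -/c => H.
  under eq_bigr do rewrite !dotvE -dotv_mulmx.
  by rewrite sumrB -dotv_suml.
move=> i; rewrite mulmxN.
apply: dotv_eq0; have /psumr_eq0P := orth (fun i => g (x i) - (A i)^T *m c).
by apply=> // j _; exact: dotv_ge0.
Qed.

(** Stationarity along [y - x] cancels the linear part of the gradient inequality, leaving only the
    strong convexity terms below [f y - f x <= 0]. *)
Lemma optimal_unique x y : optimal (@f) A b x -> optimal (@f) A b y -> y = x.
Proof.
move=> ox [fy oy].
have stat : \sum_i dotv (y i - x i) (g (x i)) = 0.
  apply: (optimal_stationary ox (v := fun i => y i - x i)).
  under eq_bigr do rewrite mulmxBr.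
  by rewrite sumrB fy ox.1 subrr.
have le0 : \sum_i mus i / 2 * dotv (y i - x i) (y i - x i) <= 0.
  have := oy x ox.1; rewrite -(subr_le0 (\sum_i f (x i))); apply: le_trans.
  rewrite -sumrB -[leLHS]add0r -{1}stat -big_split; apply: ler_sum => i _ /=.
  by have := gradient_inequality (@fg i) (x i) (y i) (@cvx i); lra.
have P i : 0 <= mus i / 2 * dotv (y i - x i) (y i - x i).
  by rewrite mulr_ge0 ?dotv_ge0 // divr_ge0 // ltW // (@cvx i).1.
have /psumr_eq0P Z : \sum_i mus i / 2 * dotv (y i - x i) (y i - x i) = 0.
  by apply/eqP; rewrite eq_le le0 sumr_ge0.
apply: functional_extensionality_dep => i; apply/eqP; rewrite -subr_eq0; apply/eqP.
apply: dotv_eq0; have /eqP := Z (fun j _ => P j) i isT.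
by rewrite mulf_eq0 gt_eqF /= ?divr_gt0 ?(@cvx i).1 // => /eqP.
Qed.

End KKT.

(** * Differentiable trajectories on the half-line *)

Section Trajectories.
Variable R : realType.

(** The regularity granted by [IDEA_solution]: right continuity at 0 and a derivative at positive
    times only. Carrying [u'] along lets derivatives be assembled by combinators. *)
Definition trajectory (V : normedModType R) (u u' : R -> V) :=
  u s @[s --> 0^'+] --> u 0 /\
  forall t : R, 0 < t -> is_derive (t : R^o) (1 : R^o) (u : R^o -> V) (u' t).

Section NormedModule.
Variable V : normedModType R.
Implicit Types u v : R -> V.

Lemma trajectory_ext u v u' v' : u =1 v -> u' =1 v' ->
  trajectory u u' -> trajectory v v'.
Proof. by move=> /funext -> /funext ->. Qed.

Lemma trajectory_cst (c : V) : trajectory (fun=> c) (fun=> 0).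
Proof. by split=> [|t _]; [exact: cvg_cst|exact: is_derive_cst]. Qed.

Lemma trajectoryD u v u' v' : trajectory u u' -> trajectory v v' ->
  trajectory (fun t => u t + v t) (fun t => u' t + v' t).
Proof.
move=> [cu du] [cv dv]; split=> [|t t0]; first exact: cvgD.
by apply: is_deriveD; [exact: du|exact: dv].
Qed.

Lemma trajectoryZ (c : R) u u' : trajectory u u' ->
  trajectory (fun t => c *: u t) (fun t => c *: u' t).
Proof.
move=> [cu du]; split=> [|t t0]; first by apply: cvgZr.
by apply: is_deriveZ; exact: du.
Qed.

Lemma trajectoryB u v u' v' : trajectory u u' -> trajectory v v' ->
  trajectory (fun t => u t - v t) (fun t => u' t - v' t).
Proof.
move=> tu tv; apply: trajectory_ext (trajectoryD tu (trajectoryZ (-1) tv)) => t;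
by rewrite scaleN1r.
Qed.

Lemma trajectory_sum n (u u' : 'I_n -> R -> V) :
  (forall i, trajectory (u i) (u' i)) ->
  trajectory (fun t => \sum_i u i t) (fun t => \sum_i u' i t).
Proof.
elim: n u u' => [|n IH] u u' uu'.
  apply: trajectory_ext (trajectory_cst 0) => t; by rewrite big_ord0.
apply: trajectory_ext (trajectoryD (uu' ord0) (IH _ _ (fun i => uu' (lift ord0 i)))).
  by move=> t; rewrite big_ord_recl.
by move=> t; rewrite big_ord_recl.
Qed.

End NormedModule.

Lemma trajectoryM (u v u' v' : R -> R) :
  trajectory (u : R -> R^o) u' -> trajectory (v : R -> R^o) v' ->
  trajectory (fun t => u t * v t : R^o) (fun t => u' t * v t + u t * v' t).
Proof.
move=> [cu du] [cv dv]; split=> [|t t0]; first exact: cvgM.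
have Du := du t t0; have Dv := dv t t0.
apply: (is_derive_eq (@is_deriveM R R^o u v t 1 _ _ Du Dv)).
by rewrite addrC; congr (_ + _); rewrite /GRing.scale /= mulrC.
Qed.

Lemma trajectory_expR (c : R) :
  trajectory (fun t => expR (c * t) : R^o) (fun t => c * expR (c * t)).
Proof.
have D (t : R) : is_derive (t : R^o) (1 : R^o)
    (fun s => expR (c * s) : R^o) (c * expR (c * t)).
  have Dc : is_derive (t : R^o) (1 : R^o) (fun s => c * s : R^o) c.
    by apply: (is_derive_eq (is_deriveZ c (is_derive_id _ _)));
      rewrite /GRing.scale /= mulr1.
  by have := is_derive1_comp (is_derive_expR (c * t)) Dc; rewrite mulrC.
split=> [|t _]; last exact: D.
have [D0 _] := D 0; apply: cvg_at_right_filter.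
have /derivable1_diffP/differentiable_continuous := D0; exact.
Qed.

Lemma trajectory_coord m k (u u' : R -> 'M[R]_(m, k)) i j :
  trajectory u u' -> trajectory (fun t => u t i j : R^o) (fun t => u' t i j).
Proof.
move=> [cu du]; split=> [|t t0].
  apply: (cvg_comp u (fun M : 'M[R]_(m, k) => M i j) cu); exact: coord_continuous.
have [Du <-] := du t t0; rewrite (derive_mx Du) mxE.
by apply/derivableP; move: Du => /derivable_mxP.
Qed.

(** The matrix norm is the maximum of the entries, so limits and derivatives can be taken
    entrywise. *)
Lemma trajectory_mx m k (u u' : R -> 'M[R]_(m, k)) :
  (forall i j, trajectory (fun t => u t i j : R^o) (fun t => u' t i j)) ->
  trajectory u u'.
Proof.
move=> H; split=> [|t t0].
  apply/cvgrPdist_le => e e0; near=> s.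
  rewrite [leLHS]/Num.Def.normr/= mx_normrE (bigmax_le _ (ltW e0))//= => i _.
  rewrite !mxE; move: i; near: s; apply: filter_forall => /= i.
  exact: ((cvgrPdist_le _ _).1 (H i.1 i.2).1).
have Du : derivable (u : R^o -> _) t 1.
  by apply/derivable_mxP => i j; have [] := (H i j).2 t t0.
apply: DeriveDef => //; rewrite (derive_mx Du); apply/matrixP => i j.
by rewrite mxE; have [_ ->] := (H i j).2 t t0.
Unshelve. all: by end_near. Qed.

Lemma trajectory_mulmx m k l (M : 'M[R]_(m, k)) (u u' : R -> 'M[R]_(k, l)) :
  trajectory u u' -> trajectory (fun t => M *m u t) (fun t => M *m u' t).
Proof.
move=> tu; apply: trajectory_mx => i j.
apply: trajectory_ext (trajectory_sum (fun q =>
  trajectoryZ (M i q) (trajectory_coord q j tu))) => t; by rewrite mxE.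
Qed.

Lemma trajectory_dotv k (u v u' v' : R -> 'cV[R]_k) :
  trajectory u u' -> trajectory v v' ->
  trajectory (fun t => dotv (u t) (v t) : R^o)
    (fun t => dotv (u' t) (v t) + dotv (u t) (v' t)).
Proof.
move=> tu tv; apply: trajectory_ext (trajectory_sum (fun q =>
  trajectoryM (trajectory_coord q 0 tu) (trajectory_coord q 0 tv))) => t //.
by rewrite big_split.
Qed.

(** Mean value theorem on [[0, t]], where right continuity suffices at the left endpoint. *)
Lemma trajectory_noninc (w w' : R -> R) : trajectory (w : R -> R^o) w' ->
  (forall t, 0 < t -> w' t <= 0) -> forall t, 0 <= t -> w t <= w 0.
Proof.
move=> [cw dw] w'0 t; rewrite le_eqVlt => /predU1P[<-//|t0].
have D s : s \in `]0, t[ -> is_derive (s : R^o) 1 (w : R^o -> R^o) (w' s).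
  by rewrite in_itv /= => /andP[s0 _]; exact: dw.
have C : {within `[0, t], continuous w}.
  apply/continuous_within_itvP => //; split=> //.
    by move=> s /D [Ds _]; apply/differentiable_continuous/derivable1_diffP.
  apply: cvg_at_left_filter; have [Dt _] := dw t t0.
  by apply/differentiable_continuous/derivable1_diffP.
have [s] := MVT t0 D C; rewrite in_itv /= => /andP[s0 _] E.
by rewrite -subr_le0 E subr0 mulr_le0_ge0 ?w'0 // ltW.
Qed.

(** The product [expR (c * t) * w t] is nonincreasing. *)
Lemma trajectory_gronwall (c : R) (w w' : R -> R) : trajectory (w : R -> R^o) w' ->
  (forall t, 0 < t -> w' t <= - c * w t) ->
  forall t, 0 <= t -> w t <= w 0 * expR (- (c * t)).
Proof.
move=> tw w'le t t0.
have := trajectory_noninc (trajectoryM (trajectory_expR c) tw) _ t0.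
rewrite mulr0 expR0 mul1r expRN ler_pdivlMr ?expR_gt0 // mulrC; apply=> s s0.
rewrite -mulrA (mulrCA c) -mulrDr pmulr_rle0 ?expR_gt0 //.
by have := w'le s s0; lra.
Qed.

End Trajectories.

(** * Lyapunov function *)

Section Lyapunov.
Variables (R : realType) (n p : nat) (d : 'I_n -> nat).
Variables (A : forall i, 'M[R]_(p, d i)) (a P : 'M[R]_n) (alpha beta : R).
Implicit Types (x h : forall i, 'cV[R]_(d i)) (lam z : 'I_n -> 'cV[R]_p).

Definition sqn (k : 'I_n -> nat) (u : forall i, 'cV[R]_(k i)) : R :=
  \sum_i dotv (u i) (u i).

Lemma sqn_ge0 k (u : forall i, 'cV[R]_(k i)) : 0 <= sqn u.
Proof. by apply: sumr_ge0 => i _; exact: dotv_ge0. Qed.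

Definition residual x z i : 'cV[R]_p := A i *m x i - z i.
Definition potential z i : 'cV[R]_p := \sum_k P i k *: z k.

(** The right-hand sides of IDEA in deviation coordinates. The gradient difference is an independent
    argument [h], constrained later only by monotonicity and a Lipschitz bound. *)
Definition xdot x h lam z i : 'cV[R]_(d i) :=
  - (alpha *: (h i + (A i)^T *m lam i)) - (A i)^T *m residual x z i.
Definition lamdot x lam z i : 'cV[R]_p :=
  residual x z i - beta *: lapl_apply a lam i.
Definition zdot lam i : 'cV[R]_p := (alpha * beta) *: lapl_apply a lam i.

Definition lyap_main x lam z : R := \sum_i
  (2^-1 * dotv (x i) (x i)
   + (2 * alpha)^-1 * dotv (alpha *: lam i + z i) (alpha *: lam i + z i)
   + (2 * beta)^-1 * dotv (potential z i) (z i)).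

(** Formal derivative of [lyap_main] along the flow. The single [potential] term stands for two
    equal halves, by symmetry of [P]. *)
Definition lyap_main_dot x h lam z : R := \sum_i
  (dotv (x i) (xdot x h lam z i)
   + alpha^-1 * dotv (alpha *: lam i + z i) (alpha *: lamdot x lam z i + zdot lam i)
   + beta^-1 * dotv (potential z i) (zdot lam i)).

Definition lyap_cross x lam z : R := \sum_i dotv (lam i) (residual x z i).

Definition lyap_cross_dot x h lam z : R := \sum_i
  (dotv (lamdot x lam z i) (residual x z i)
   + dotv (lam i) (A i *m xdot x h lam z i - zdot lam i)).

Hypothesis alpha0 : 0 < alpha.
Hypothesis beta0 : 0 < beta.
Hypothesis undir : undirected_graph a.
Hypothesis conn : graph_connected a.
Hypothesis rankA : \rank (Arow A) = p.
Hypothesis P_section : forall z, \sum_i z i = 0 ->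
  forall i, lapl_apply a (potential z) i = z i.

Lemma lyap_main_dotE x h lam z : \sum_i z i = 0 ->
  lyap_main_dot x h lam z =
    - alpha * \sum_i dotv (x i) (h i) - sqn (residual x z).
Proof.
move=> z0.
have adj : \sum_i dotv (potential z i) (lapl_apply a lam i) =
    \sum_i dotv (z i) (lam i).
  by rewrite lapl_apply_adj //; apply: eq_bigr => i _; rewrite P_section.
(* The added bracket vanishes only after summation over agents; with it included, the identity holds
   agent by agent. *)
transitivity (- alpha * \sum_i dotv (x i) (h i) - sqn (residual x z)
   + alpha * (\sum_i dotv (potential z i) (lapl_apply a lam i)
   - \sum_i dotv (z i) (lam i))); last by rewrite adj subrr mulr0 addr0.
rewrite /sqn !mulrBr !mulr_sumr -!sumrB -!big_split /=; apply: eq_bigr => i _.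
have Ax v : dotv (x i) ((A i)^T *m v) = dotv (residual x z i) v + dotv (z i) v.
  by rewrite -dotv_mulmx -dotvDl subrK.
rewrite /xdot /lamdot /zdot.
move: (residual x z i) (potential z i) (lapl_apply a lam i) Ax => y U m Ax.
rewrite !dotvE !Ax (dotvC (lam i) y) (dotvC (z i) y) (dotvC (z i) (lam i)).
by field; rewrite !gt_eqF.
Qed.

Lemma sqn_lapl_le : exists K, 0 < K /\ forall lam,
  sqn (lapl_apply a lam) <= K * lapl_energy a lam.
Proof.
have [K [K0 HK]] := lapl_apply_le_energy p undir.
exists (1 + n%:R * K); split; first by rewrite ltr_pwDl // mulr_ge0 // ltW.
move=> lam; rewrite mulrDl mul1r -[leLHS]add0r lerD ?lapl_energy_ge0 //.
by rewrite -mulrA mulr_natl -[X in _ *+ X]card_ord -sumr_const; exact: ler_sum.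
Qed.

(** The term [<lam, A x' - z'>] yields [- alpha |A^T lam|^2 - alpha beta <lam, L lam>]. Half of each
    is spent, through Young's inequality, on the products of [A^T lam] with [h] and [A^T y] and of
    [L lam] with [y]. *)
Lemma lyap_cross_dot_le : exists K, 0 < K /\ forall (Kh : R) x h lam z, 0 <= Kh ->
  (forall i, dotv (h i) (h i) <= Kh * dotv (x i) (x i)) ->
  lyap_cross_dot x h lam z <=
    - (alpha / 2) * (sqn (fun i => (A i)^T *m lam i) + beta * lapl_energy a lam)
    + alpha * Kh * sqn x + K * sqn (residual x z).
Proof.
have [k7 [k70 H7]] := sqn_lapl_le.
have [KA [KA0 HA]] := mulmx_family_bounded (fun i => (A i)^T).
(* Chosen so that [beta * c * k7 = alpha * beta / 2], half of the available energy. *)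
pose c := alpha / (2 * k7).
have c0 : 0 < c by rewrite divr_gt0 // mulr_gt0.
have c40 : 0 < (4 * c)^-1 by rewrite invr_gt0 mulr_gt0.
exists (1 + alpha^-1 * KA + beta * (4 * c)^-1); split.
  by rewrite !addr_gt0 // mulr_gt0 // invr_gt0.
move=> Kh x h lam z Kh0 hx.
set y := residual x z; set m := lapl_apply a lam.
have cE : beta * c * sqn m <= alpha / 2 * (beta * lapl_energy a lam).
  have -> : alpha / 2 * (beta * lapl_energy a lam) =
      beta * c * (k7 * lapl_energy a lam).
    by rewrite /c; field; rewrite gt_eqF.
  by rewrite ler_wpM2l ?H7 // ltW // mulr_gt0.
rewrite -subr_ge0 in cE; rewrite -subr_ge0; apply: le_trans cE _.
rewrite -subr_ge0.
(* The energy estimate [cE] is global and has been spent already; what remains of the gap splits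
   into agentwise terms [G i], each nonnegative by [Y1] to [Y4]. *)
pose G i := - dotv (lamdot x lam z i) (y i)
  - dotv (lam i) (A i *m xdot x h lam z i - zdot lam i)
  - alpha / 2 * dotv ((A i)^T *m lam i) ((A i)^T *m lam i)
  + alpha * Kh * dotv (x i) (x i)
  + (1 + alpha^-1 * KA + beta * (4 * c)^-1) * dotv (y i) (y i)
  - alpha * beta * dotv (lam i) (m i)
  + beta * c * dotv (m i) (m i).
rewrite [leRHS](_ : _ = \sum_i G i); last first.
  rewrite /lyap_cross_dot /sqn /lapl_energy -/y -/m /G.
  by rewrite !big_split /= !sumrN -!mulr_sumr; field; rewrite !gt_eqF.
apply: sumr_ge0 => i _; rewrite /G /lamdot /xdot /zdot -/y -/m.
have adj v : dotv (lam i) (A i *m v) = dotv ((A i)^T *m lam i) v.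
  by rewrite dotvC dotv_mulmx dotvC.
move: (y i) (m i) => {G y m} y m.
set q := (A i)^T *m lam i in adj *.
have Y1 : beta * - dotv m y <= beta * (c * dotv m m + (4 * c)^-1 * dotv y y).
  by rewrite ler_pM2l // -dotvNl; have := dotv_young (- m) y c0; rewrite !dotvE opprK.
have Y2 : alpha * - dotv q (h i) <= alpha * (4^-1 * dotv q q + dotv (h i) (h i)).
  rewrite ler_pM2l //; have q0 : (0 : R) < 4^-1 by rewrite invr_gt0.
  have := dotv_young (- q) (h i) q0.
  by rewrite !dotvE opprK divff ?invr1 ?mul1r.
have Y3 : - dotv q ((A i)^T *m y) <= alpha / 4 * dotv q q + alpha^-1 * (KA * dotv y y).
  have a40 : 0 < alpha / 4 by rewrite divr_gt0.
  have := dotv_young (- q) ((A i)^T *m y) a40.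
  have -> : 4 * (alpha / 4) = alpha by field.
  rewrite !dotvE opprK => /le_trans; apply.
  by rewrite lerD2l ler_pM2l ?invr_gt0.
have Y4 : alpha * dotv (h i) (h i) <= alpha * (Kh * dotv (x i) (x i)).
  by rewrite ler_pM2l.
rewrite dotvDr dotvNr adj !dotvE; lra.
Qed.

(** The second bound is how dissipation in [x] and in the residual reaches [z]. *)
Lemma residual_bounds : exists K, 0 < K /\ forall x z,
  sqn (residual x z) <= K * sqn x + 2 * sqn z /\
  sqn z <= K * sqn x + 2 * sqn (residual x z).
Proof.
have [K [K0 HK]] := mulmx_family_bounded (fun i => A i).
have ineq k (u v w : 'cV[R]_k) : w = u - v ->
    dotv w w <= 2 * dotv u u + 2 * dotv v v.
  by move=> ->; have := dotvD_le u (- v); rewrite !dotvE opprK.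
exists (2 * K); split=> [|x z]; first by rewrite mulr_gt0.
rewrite /sqn !mulr_sumr -!big_split /=; split; apply: ler_sum => i _.
  apply: le_trans (ineq _ (A i *m x i) (z i) (residual x z i) erefl) _.
  by rewrite lerD2r -mulrA ler_pM2l.
have zE : z i = A i *m x i - residual x z i by rewrite opprB addrC subrK.
apply: le_trans (ineq _ _ _ _ zE) _.
by rewrite lerD2r -mulrA ler_pM2l.
Qed.

(** With [U = P z], the identity [L U = z] turns [<P z, z>] into the energy of [U], which dominates
    [|L U|^2 = |z|^2] up to a constant. The upper bound uses the entries of [P]. *)
Lemma potential_bounds : exists k1 k2, 0 < k1 /\ 0 < k2 /\ forall z, \sum_i z i = 0 ->
  sqn z <= k1 * \sum_i dotv (potential z i) (z i) /\
  \sum_i dotv (potential z i) (z i) <= k2 * sqn z.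
Proof.
have [k1 [k10 H1]] := sqn_lapl_le.
have [K [K0 HK]] : exists K, 0 < K /\ forall ij, P ij.1 ij.2 ^+ 2 <= K.
  apply: common_bound => [ij u v uv H|ij]; first exact: le_trans H uv.
  by exists (P ij.1 ij.2 ^+ 2).
exists k1, (1 + n%:R * (n%:R * K)); split=> //; split.
  by rewrite ltr_pwDl // !mulr_ge0 // ltW.
move=> z z0; split.
  have -> : \sum_i dotv (potential z i) (z i) = lapl_energy a (potential z).
    by apply: eq_bigr => i _; rewrite P_section.
  apply: le_trans (H1 (potential z)).
  suff -> : sqn (lapl_apply a (potential z)) = sqn z by [].
  by apply: eq_bigr => i _; rewrite P_section.
have pot i : dotv (potential z i) (potential z i) <= n%:R * K * sqn z.
  apply: le_trans; first exact: dotv_sum_le.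
  rewrite -mulrA ler_wpM2l // mulr_sumr; apply: ler_sum => k _.
  by rewrite dotvZl dotvZr mulrA -expr2 ler_wpM2r ?dotv_ge0 // (HK (i, k)).
apply: (@le_trans _ _ (\sum_i (n%:R * K * sqn z + dotv (z i) (z i)))).
  apply: ler_sum => i _; have := pot i.
  have := dotv_ge0 (potential z i - z i); have := dotv_ge0 (z i).
  have := dotv_ge0 (potential z i).
  by rewrite dotvDl !dotvDr !dotvNr !dotvNl (dotvC (z i) (potential z i)); lra.
rewrite big_split sumr_const card_ord -mulr_natl -/(sqn z) /=.
by rewrite le_eqVlt; apply/orP; left; apply/eqP; ring.
Qed.

Lemma pick_small (c k1 k2 k3 : R) : 0 < c -> 0 < k1 -> 0 < k2 -> 0 < k3 ->
  exists e, 0 < e /\ [/\ e * k1 <= c, e * k2 <= c & e * k3 <= c].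
Proof.
move=> c0 k10 k20 k30; pose s := k1 + k2 + k3.
have s0 : 0 < s by rewrite !addr_gt0.
exists (c / s); split; first exact: divr_gt0.
by split; rewrite mulrAC ler_pdivrMr // ler_pM2l // /s; lra.
Qed.

(** Makes [lyap_main] comparable to the squared deviation on zero-sum [z], and the cross term at
    most of that order. *)
Lemma lyap_bounds : exists c0 k6 k5, [/\ 0 < c0, 0 < k6, 0 < k5 &
  forall x lam z, \sum_i z i = 0 ->
  [/\ c0 * (sqn x + sqn lam + sqn z) <= lyap_main x lam z,
      lyap_main x lam z <= k6 * (sqn x + sqn lam + sqn z) &
      `|lyap_cross x lam z| <= k5 * (sqn x + sqn lam + sqn z)]].
Proof.
have [k1 [k2 [k10 [k20 Hpot]]]] := potential_bounds.
have [k3 [k30 Hres]] := residual_bounds.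
pose SQ lam z := sqn (fun i => alpha *: lam i + z i).
have mainE x lam z : lyap_main x lam z = 2^-1 * sqn x
    + (2 * alpha)^-1 * SQ lam z
    + (2 * beta)^-1 * \sum_i dotv (potential z i) (z i).
  by rewrite /lyap_main !big_split /= -!mulr_sumr.
have SQ_le lam z : SQ lam z <= 2 * alpha ^+ 2 * sqn lam + 2 * sqn z.
  rewrite /SQ /sqn !mulr_sumr -big_split; apply: ler_sum => i _ /=.
  apply: le_trans; first exact: dotvD_le.
  by rewrite dotvZl dotvZr expr2 !mulrA.
have SQ_ge lam z : alpha ^+ 2 / 2 * sqn lam - sqn z <= SQ lam z.
  rewrite /SQ /sqn mulr_sumr -sumrB; apply: ler_sum => i _ /=.
  have := dotvD_le (alpha *: lam i + z i) (- z i); rewrite addrK.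
  by rewrite dotvZl dotvZr dotvNl dotvNr expr2; lra.
have a20 : 0 < (2 * alpha)^-1 by rewrite invr_gt0 mulr_gt0.
have b20 : 0 < (2 * beta)^-1 by rewrite invr_gt0 mulr_gt0.
(* The choice makes [e * S] fit under the middle term and [2 * e * |z|^2] under the last. Since
   [SQ_ge] loses [e * |z|^2], a net [e * |z|^2] survives. *)
have [e [e0 [e1 e2 _]]] := pick_small ltr01
  (mulr_gt0 (ltr0n R 2) alpha0) (mulr_gt0 (mulr_gt0 (ltr0n R 4) beta0) k10) ltr01.
have a2e0 : 0 < e * alpha ^+ 2 / 2 by rewrite !mulr_gt0 // ?exprn_gt0 ?invr_gt0.
have Va2e0 : 0 < (e * alpha ^+ 2 / 2)^-1 by rewrite invr_gt0.
have Ve0 : 0 < e^-1 by rewrite invr_gt0.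
have [c0 [c00 [cX cL cZ]]] := pick_small ltr01 (ltr0n R 2) Va2e0 Ve0.
rewrite ler_pdivrMr ?mul1r // in cL; rewrite ler_pdivrMr ?mul1r // in cZ.
exists c0, (1 + (2 * alpha)^-1 * (2 * alpha ^+ 2) + (2 * alpha)^-1 * 2
            + (2 * beta)^-1 * k2), (1 + k3 + 2); split=> //.
- by rewrite !addr_gt0 // ?mulr_gt0 ?exprn_gt0.
- by rewrite !addr_gt0.
move=> x lam z z0; have [HZ HV] := Hpot z z0; have [HY _] := Hres x z.
have X0 := sqn_ge0 x; have L0 := sqn_ge0 lam; have Z0 := sqn_ge0 z.
rewrite mainE; set V := \sum_i _ in HZ HV *.
move: (SQ_le lam z) (SQ_ge lam z) => Sle Sge.
have S0 : 0 <= SQ lam z by exact: sqn_ge0.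
move: (SQ lam z) Sle Sge S0 => S Sle Sge S0.
have V0 : 0 <= V by rewrite -(pmulr_rge0 _ k10) (le_trans Z0).
split.
- have T1 : e * S <= (2 * alpha)^-1 * S.
    by rewrite ler_wpM2r // -[leRHS]mul1r ler_pdivlMr // mulr_gt0.
  have T2 : 2 * e * (k1 * V) <= (2 * beta)^-1 * V.
    rewrite mulrA ler_wpM2r // -[leRHS]mul1r ler_pdivlMr ?mulr_gt0 //; lra.
  have T3 : 2 * e * sqn z <= 2 * e * (k1 * V) by rewrite ler_pM2l // mulr_gt0.
  have T4 : e * (alpha ^+ 2 / 2 * sqn lam - sqn z) <= e * S by rewrite ler_pM2l.
  have T5 : c0 * sqn x <= 2^-1 * sqn x by rewrite ler_wpM2r //; lra.
  have T6 : c0 * sqn lam <= e * alpha ^+ 2 / 2 * sqn lam by rewrite ler_wpM2r.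
  have T7 : c0 * sqn z <= e * sqn z by rewrite ler_wpM2r.
  lra.
- have T1 : (2 * alpha)^-1 * S <=
      (2 * alpha)^-1 * (2 * alpha ^+ 2 * sqn lam + 2 * sqn z) by rewrite ler_pM2l.
  have T2 : (2 * beta)^-1 * V <= (2 * beta)^-1 * (k2 * sqn z) by rewrite ler_pM2l.
  have pos k u : 0 < k -> 0 <= u -> 0 <= k * u :> R.
    by move=> k0 u0; rewrite mulr_ge0 // ltW.
  have B0 := mulr_gt0 b20 k20.
  have A0 : 0 < (2 * alpha)^-1 * (2 * alpha ^+ 2) by rewrite !mulr_gt0 ?exprn_gt0.
  have := pos _ _ a20 X0; have := pos _ _ a20 L0.
  have := pos _ _ B0 X0; have := pos _ _ B0 L0; have := pos _ _ A0 X0.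
  have := pos _ _ A0 Z0.
  move: T1 T2.
  rewrite mulrDr mulrA [_ * (2 * sqn z)]mulrA [_ * (k2 * _)]mulrA.
  lra.
have T1 : `|lyap_cross x lam z| <= sqn lam + sqn (residual x z).
  rewrite /lyap_cross /sqn -big_split; apply: le_trans (ler_norm_sum _ _ _) _.
  apply: ler_sum => i _ /=; rewrite ler_norml.
  move: (residual x z i) => y; have := dotv_ge0 (lam i); have := dotv_ge0 y.
  have := dotv_ge0 (lam i - y); have := dotv_ge0 (lam i + y).
  by rewrite !dotvE (dotvC y); lra.
have := mulr_ge0 (ltW k30) L0; have := mulr_ge0 (ltW k30) Z0.
lra.
Qed.

(** The constants depend on [h] only through [mu] and [Kh], hence serve at all times of a
    trajectory. *)
Lemma lyapunov_decay (mu Kh : R) : 0 < mu -> 0 < Kh ->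
  exists eps c gam : R, [/\ 0 < c, 0 < gam &
  forall x h lam z, \sum_i z i = 0 ->
  (forall i, mu * dotv (x i) (x i) <= dotv (x i) (h i)) ->
  (forall i, dotv (h i) (h i) <= Kh * dotv (x i) (x i)) ->
  c * (sqn x + sqn lam + sqn z) <= lyap_main x lam z + eps * lyap_cross x lam z /\
  lyap_main_dot x h lam z + eps * lyap_cross_dot x h lam z
    <= - gam * (lyap_main x lam z + eps * lyap_cross x lam z)].
Proof.
move=> mu0 Kh0.
have [c0 [k6 [k5 [c00 k60 k50 Hb]]]] := lyap_bounds.
have [K [K0 Hc]] := lyap_cross_dot_le.
have [k3 [k30 Hres]] := residual_bounds.
have [k4 [k40 Hcoer]] := consensus_coercive undir conn rankA.
have aKh0 : 0 < alpha * Kh by rewrite mulr_gt0.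
have am0 : 0 < alpha * mu by rewrite mulr_gt0.
have half0 : (0 : R) < 2^-1 by rewrite invr_gt0.
have quarter0 : (0 : R) < 4^-1 by rewrite invr_gt0.
(* The first condition keeps the cross term below half of the lower bound of [lyap_main]; the other
   two keep its error terms below half of the dissipation in [x] and in the residual. *)
have [eps [eps0 [ec eX eY]]] :=
  pick_small half0 (divr_gt0 k50 c00) (divr_gt0 aKh0 am0) K0.
rewrite mulrA ler_pdivrMr // in ec; rewrite mulrA ler_pdivrMr // in eX.
pose r := eps * (alpha / 2).
have r0 : 0 < r by rewrite mulr_gt0 // divr_gt0.
have kX0 : 0 < (1 + k3) / (alpha * mu) + 1.
  by rewrite addr_gt0 // divr_gt0 // addr_gt0.
(* [kap * N] has to fit into the remaining dissipation: [lam] is paid through [Hcoer], [z] through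
   [R1]. The summand 1 in [kX0] also yields [kap <= 1/4] for the residual. *)
have [kap [kap0 [kX kQ kE]]] := pick_small quarter0 kX0 (divr_gt0 k40 r0)
  (divr_gt0 k40 (mulr_gt0 r0 beta0)).
pose k8 := k6 + eps * k5.
have k80 : 0 < k8 by rewrite addr_gt0 // mulr_gt0.
(* The rate divides the dissipation constant [kap] by the upper constant [k8] of the full Lyapunov
   function. *)
exists eps, (c0 / 2), (kap / k8); split; rewrite ?divr_gt0 //.
move=> x h lam z z0 hmon hlip.
have [B1 B2 B3] := Hb x lam z z0; have [_ R1] := Hres x z.
set N := sqn x + sqn lam + sqn z in B1 B2 B3 *.
have X0 := sqn_ge0 x; have L0 := sqn_ge0 lam; have Z0 := sqn_ge0 z.
have N0 : 0 <= N by rewrite !addr_ge0.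
have Tn : eps * `|lyap_cross x lam z| <= eps * (k5 * N) by rewrite ler_pM2l.
have [Tl Tu] : - (eps * (k5 * N)) <= eps * lyap_cross x lam z /\
    eps * lyap_cross x lam z <= eps * (k5 * N).
  by apply/andP; rewrite -ler_norml normrM (gtr0_norm eps0).
have ecN : eps * k5 * N <= 2^-1 * c0 * N by rewrite ler_wpM2r.
split; first lra.
have le_k8 : lyap_main x lam z + eps * lyap_cross x lam z <= k8 * N.
  by rewrite /k8; lra.
apply: (@le_trans _ _ (- kap * N)); last first.
  rewrite !mulNr lerN2 mulrAC ler_pdivrMr // -mulrA (mulrC N) ler_pM2l //.
rewrite lyap_main_dotE //.
have := Hc Kh x h lam z (ltW Kh0) hlip; rewrite -(ler_pM2l eps0).
have mon : mu * sqn x <= \sum_i dotv (x i) (h i).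
  by rewrite /sqn mulr_sumr; exact: ler_sum.
rewrite -(ler_pM2l alpha0) in mon.
have := Hcoer lam; rewrite -/(sqn lam) -/(sqn (fun i => (A i)^T *m lam i)).
have Q0 := sqn_ge0 (fun i => (A i)^T *m lam i).
have E0 := lapl_energy_ge0 undir lam.
have Y0 := sqn_ge0 (residual x z).
move: (sqn (fun i => (A i)^T *m lam i)) (lapl_energy a lam)
  (sqn (residual x z)) R1 Q0 E0 Y0.
move=> Q E Y R1 Q0 E0 Y0 L1 D1.
rewrite mulrDr in kX.
have kap_le : kap <= 4^-1.
  have : 0 <= kap * ((1 + k3) / (alpha * mu)).
    by rewrite mulr_ge0 ?divr_ge0 ?addr_ge0 // ltW.
  lra.
have kX' : kap * (1 + k3) <= 4^-1 * (alpha * mu).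
  by rewrite -ler_pdivrMr //; lra.
rewrite !mulrA !ler_pdivrMr ?mulr_gt0 // in kQ kE.
have T1 : kap * sqn lam <= kap * (k4 * (Q + E)) by rewrite ler_pM2l.
have T2 : kap * sqn z <= kap * (k3 * sqn x + 2 * Y) by rewrite ler_pM2l.
have T3 : kap * k4 * Q <= 4^-1 * r * Q by rewrite ler_wpM2r.
have T4 : kap * k4 * E <= 4^-1 * (r * beta) * E by rewrite ler_wpM2r.
have T5 : kap * (1 + k3) * sqn x <= 4^-1 * (alpha * mu) * sqn x by rewrite ler_wpM2r.
have T6 : kap * Y <= 4^-1 * Y by rewrite ler_wpM2r.
have T7 : eps * (alpha * Kh) * sqn x <= 2^-1 * (alpha * mu) * sqn x.
  by rewrite ler_wpM2r.
have T8 : eps * K * Y <= 2^-1 * Y by rewrite ler_wpM2r.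
have T9 : 0 <= r * Q by rewrite mulr_ge0 // ltW.
have T10 : 0 <= r * beta * E by rewrite !mulr_ge0 // ltW.
have T11 : 0 <= alpha * mu * sqn x by rewrite mulr_ge0 // ltW.
rewrite /N; move: D1 T3 T4 T9 T10; rewrite /r; lra.
Qed.

End Lyapunov.

(** * Differentiating the Lyapunov function along trajectories *)

Section LyapunovTrajectory.
Variables (R : realType) (n p : nat) (d : 'I_n -> nat).
Variables (A : forall i, 'M[R]_(p, d i)) (a P : 'M[R]_n) (alpha beta : R).
Variables (x h : R -> forall i, 'cV[R]_(d i)) (lam z : R -> 'I_n -> 'cV[R]_p).

Hypothesis P_sym : P^T = P.
Hypothesis x_traj : forall i, trajectory (fun t => x t i)
  (fun t => xdot A alpha (x t) (h t) (lam t) (z t) i).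
Hypothesis lam_traj : forall i, trajectory (fun t => lam t i)
  (fun t => lamdot A a beta (x t) (lam t) (z t) i).
Hypothesis z_traj : forall i, trajectory (fun t => z t i)
  (fun t => zdot a alpha beta (lam t) i).

Lemma potential_adj (u v : 'I_n -> 'cV[R]_p) :
  \sum_i dotv (potential P u i) (v i) = \sum_i dotv (potential P v i) (u i).
Proof.
under eq_bigr do rewrite dotv_suml.
under [RHS]eq_bigr do rewrite dotv_suml.
rewrite exchange_big; apply: eq_bigr => i _; apply: eq_bigr => j _.
by rewrite !dotvZl -{1}P_sym mxE dotvC.
Qed.

Lemma lyap_main_trajectory :
  trajectory (fun t => lyap_main P alpha beta (x t) (lam t) (z t) : R^o)
    (fun t => lyap_main_dot A a P alpha beta (x t) (h t) (lam t) (z t)).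
Proof.
have w_traj i : trajectory (fun t => alpha *: lam t i + z t i) (fun t =>
    alpha *: lamdot A a beta (x t) (lam t) (z t) i + zdot a alpha beta (lam t) i).
  exact: trajectoryD (trajectoryZ _ (lam_traj i)) (z_traj i).
have U_traj i : trajectory (fun t => potential P (z t) i)
    (fun t => potential P (zdot a alpha beta (lam t)) i).
  by apply: trajectory_sum => k; exact: trajectoryZ.
apply: trajectory_ext (trajectory_sum (fun i => trajectoryD (trajectoryD
  (trajectoryZ 2^-1 (trajectory_dotv (x_traj i) (x_traj i)))
  (trajectoryZ (2 * alpha)^-1 (trajectory_dotv (w_traj i) (w_traj i))))
  (trajectoryZ (2 * beta)^-1 (trajectory_dotv (U_traj i) (z_traj i))))) => t //.
rewrite /lyap_main_dot !big_split /=; congr (_ + _ + _).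
- apply: eq_bigr => i _; rewrite (dotvC (x t i)) /GRing.scale /=; lra.
- apply: eq_bigr => i _; rewrite (dotvC (alpha *: lam t i + _)) /GRing.scale /=.
  by rewrite invfM; lra.
(* Symmetry of [P] identifies [<P z', z>] with [<P z, z'>] after summation. *)
- rewrite -scaler_sumr -mulr_sumr big_split /= potential_adj /GRing.scale /=.
  by rewrite invfM; lra.
Qed.

Lemma lyap_cross_trajectory :
  trajectory (fun t => lyap_cross A (x t) (lam t) (z t) : R^o)
    (fun t => lyap_cross_dot A a alpha beta (x t) (h t) (lam t) (z t)).
Proof.
apply: trajectory_sum => i; apply: trajectory_dotv; first exact: lam_traj.
by apply: trajectoryB => //; exact: trajectory_mulmx.
Qed.

End LyapunovTrajectory.

(** * Equilibrium, deviation coordinates and exponential convergence *)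

Theorem theorem2 (R : realType) (n p : nat) (d : 'I_n -> nat)
  (f : forall i, 'cV[R]_(d i) -> R) (gf : forall i, 'cV[R]_(d i) -> 'cV[R]_(d i))
  (A : forall i, 'M[R]_(p, d i)) (b : 'cV[R]_p) (bs : 'I_n -> 'cV[R]_p)
  (a : 'M[R]_n) (mus ls : 'I_n -> R) (mu l alpha beta phi : R)
  (X : R -> forall i, 'cV[R]_(d i)) (Lam Z : R -> 'I_n -> 'cV[R]_p) :
  (* Assumption 1 with X_i = R^{d_i} *)
  (forall i, has_gradient (f i) (gf i)) ->
  (forall i, locally_lipschitz (gf i)) ->
  (exists x, feasible A b x) ->                      (* Slater *)
  (exists x, optimal f A b x) ->                     (* (P) has an optimal solution *)
  (* graph undirected and connected *)
  undirected_graph a -> graph_connected a ->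
  (* A has full row rank *)
  \rank (Arow A) = p ->
  (* strong convexity and smoothness *)
  (forall i, strongly_convex (mus i) (f i)) ->
  (forall i, lipschitz_grad (ls i) (gf i)) ->
  (forall i, mu <= mus i) -> (exists i, mu = mus i) ->
  (forall i, ls i <= l) -> (exists i, l = ls i) ->
  (* splitting of b *)
  \sum_(i < n) bs i = b ->
  (* parameters *)
  0 < beta -> 0 < phi ->
  phi > Num.max (l / 2 - 1) (2 * sigma_max (Adiag A) ^+ 2) ->
  alpha > Num.max 1
    ((phi * sigma_max (Adiag A) ^+ 2 / mu + l / 2) / (phi + 1 - l / 2)) ->
  (* trajectory of IDEA with sum_i z_i(0) = 0 *)
  \sum_(i < n) Z 0 i = 0 ->
  IDEA_solution alpha beta gf A bs a X Lam Z ->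
  exists (xs : forall i, 'cV[R]_(d i)) (lams zs : 'I_n -> 'cV[R]_p),
    optimal f A b xs /\ (forall y, optimal f A b y -> y = xs) /\
    exists C c : R, 0 < C /\ 0 < c /\
      forall t : R, 0 <= t ->
        state_dist (X t) xs (Lam t) lams (Z t) zs <= C * expR (- (c * t)).
Proof.
move=> fg _ _ [xs xs_opt] undir conn rankA cvx lip mu_le [i0 muE] _ _ bsE
  beta0 _ _ + Z0 [init ode].
rewrite gt_max => /andP[/(lt_trans ltr01) alpha0 _].
have mu0 : 0 < mu by rewrite muE; exact: (cvx i0).1.
have [Kh [Kh0 HKh]] : exists K, 0 < K /\ forall i, ls i ^+ 2 <= K.
  apply: common_bound => [i u v uv H|i]; first exact: le_trans H uv.
  by exists (ls i ^+ 2).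
have [lam0 kkt] := kkt_multiplier fg cvx lip rankA xs_opt.
have [P [P_sym P_section]] := lapl_section undir conn.
(* An equilibrium of IDEA: consensus on the KKT multiplier kills the Laplacian terms, and [zs] makes
   the residual vanish. *)
pose lams (i : 'I_n) := lam0; pose zs i : 'cV[R]_p := A i *m xs i - bs i.
exists xs, lams, zs; split=> //; split.
  by move=> y; exact: (optimal_unique fg cvx lip xs_opt).
pose x t i : 'cV[R]_(d i) := X t i - xs i.
pose lam t i : 'cV[R]_p := Lam t i - lams i.
pose z t i : 'cV[R]_p := Z t i - zs i.
pose h t i : 'cV[R]_(d i) := gf i (X t i) - gf i (xs i).
have yE t i : A i *m X t i - bs i - Z t i = residual A (x t) (z t) i.
  by rewrite /residual /x /z /zs mulmxBr !opprB !addrA subrK.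
have mE t i : lapl_apply a (Lam t) i = lapl_apply a (lam t) i.
  by rewrite lapl_applyB lapl_apply_cst subr0.
have x_traj i : trajectory (fun t => x t i)
    (fun t => xdot A alpha (x t) (h t) (lam t) (z t) i).
  have tX : trajectory (fun t => X t i) _ :=
    conj (init i).1 (fun t t0 => (ode t t0 i).1).
  apply: trajectory_ext (trajectoryB tX (trajectory_cst (xs i))) => t //.
  rewrite subr0 yE /xdot; congr (- (_ *: _) - _).
  by rewrite /h /lam mulmxBr addrACA -opprD kkt subr0.
have lam_traj i : trajectory (fun t => lam t i)
    (fun t => lamdot A a beta (x t) (lam t) (z t) i).
  have tLam : trajectory (fun t => Lam t i) _ :=
    conj (init i).2.1 (fun t t0 => (ode t t0 i).2.1).
  apply: trajectory_ext (trajectoryB tLam (trajectory_cst (lams i))) => t //.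
  by rewrite subr0 yE mE.
have z_traj i : trajectory (fun t => z t i)
    (fun t => zdot a alpha beta (lam t) i).
  have tZ : trajectory (fun t => Z t i) _ :=
    conj (init i).2.2 (fun t t0 => (ode t t0 i).2.2).
  apply: trajectory_ext (trajectoryB tZ (trajectory_cst (zs i))) => t //.
  by rewrite subr0 mE.
(* The Laplacian has zero-sum image, so the total of [z] has zero derivative; its squared norm is
   then nonincreasing from 0. Initially, [zs] sums to [b - b = 0] by feasibility. *)
have z_sum0 t : 0 <= t -> \sum_i z t i = 0.
  move=> t0; have S_traj := trajectory_sum z_traj.
  have S0 : \sum_i z 0 i = 0.
    by rewrite sumrB Z0 sumrB xs_opt.1 bsE subrr subr0.
  have S'0 s : \sum_i zdot a alpha beta (lam s) i = 0.
    by rewrite -scaler_sumr lapl_apply_sum0 // scaler0.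
  apply: dotv_eq0; apply/eqP; rewrite eq_le dotv_ge0 andbT.
  have -> : 0 = dotv (\sum_i z 0 i) (\sum_i z 0 i) by rewrite S0 dotv0l.
  apply: (trajectory_noninc (trajectory_dotv S_traj S_traj)) (t0) => s _.
  by rewrite S'0 dotv0l dotvC dotv0l addr0.
have [eps [c [gam [c0 gam0 decay]]]] :=
  lyapunov_decay alpha0 beta0 undir conn rankA (P_section p) mu0 Kh0.
have mono t i : mu * dotv (x t i) (x t i) <= dotv (x t i) (h t i).
  apply: le_trans (strongly_monotone (fg i) (X t i) (xs i) (cvx i)).
  by rewrite ler_wpM2r ?dotv_ge0.
have hlip t i : dotv (h t i) (h t i) <= Kh * dotv (x t i) (x t i).
  apply: le_trans (lipschitz_grad_sqr (X t i) (xs i) (lip i)) _.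
  by rewrite ler_wpM2r ?dotv_ge0.
pose W t := lyap_main P alpha beta (x t) (lam t) (z t)
  + eps * lyap_cross A (x t) (lam t) (z t).
have W_traj := trajectoryD (lyap_main_trajectory P_sym x_traj lam_traj z_traj)
  (trajectoryZ eps (lyap_cross_trajectory x_traj lam_traj z_traj)).
have W_le t : 0 <= t -> W t <= W 0 * expR (- (gam * t)).
  apply: (trajectory_gronwall W_traj) => s s0.
  exact: (decay _ _ (lam s) _ (z_sum0 s (ltW s0)) (mono s) (hlip s)).2.
have distE t : state_dist (X t) xs (Lam t) lams (Z t) zs ^+ 2 =
    sqn (x t) + sqn (lam t) + sqn (z t).
  rewrite sqr_sqrtr; last by apply: sumr_ge0 => i _; rewrite !addr_ge0 ?sqr_ge0.
  by rewrite -!big_split; apply: eq_bigr => i _; rewrite !enorm_sqr.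
have dist_le t : 0 <= t ->
    c * state_dist (X t) xs (Lam t) lams (Z t) zs ^+ 2 <= W t.
  move=> t0; rewrite distE.
  exact: (decay _ _ (lam t) _ (z_sum0 t t0) (mono t) (hlip t)).1.
have W00 : 0 <= W 0 / c.
  by rewrite divr_ge0 ?(ltW c0) // (le_trans _ (dist_le 0 _)) // mulr_ge0 ?sqr_ge0 ?ltW.
(* [W] controls the squared distance, whence the square root and the halved rate; the summand 1
   ensures positivity when [W 0 = 0]. *)
exists (1 + Num.sqrt (W 0 / c)), (gam / 2); split; last split.
- by rewrite ltr_pwDl // sqrtr_ge0.
- by rewrite divr_gt0.
move=> t t0; have sq0 := sqrtr_ge0 (W 0 / c).
apply: (@le_trans _ _ (Num.sqrt (W 0 / c) * expR (- (gam / 2 * t)))); last first.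
  by rewrite ler_wpM2r ?expR_ge0 // lerDr.
rewrite -(@ler_pXn2r _ 2) ?nnegrE ?sqrtr_ge0 ?mulr_ge0 ?expR_ge0 //.
rewrite exprMn (sqr_sqrtr W00) [expR _ ^+ 2]expr2 -expRD.
have -> : - (gam / 2 * t) + - (gam / 2 * t) = - (gam * t) by field.
rewrite mulrAC ler_pdivlMr // mulrC; apply: le_trans (dist_le t t0) _.
exact: W_le.
Qed.
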